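(* Let $f$ be a block function on $(\omega,<)$ which is not intrinsically computable on a cone. Then $f$ is intrinsically of c.e. degree on a cone if and only if there are infinitely many $f$-blocks that do not embed into a later $f$-block.
   Context: Let $(\omega,<)$ be the standard order on $\omega$. A copy of $(\omega,<)$ is a linear order $\mathcal{L}=(L,\prec)$ with $L\subseteq\omega$ isomorphic to $(\omega,<)$; it is $X$-computable if $L,\prec$ are $X$-computable. With $\pi_{\mathcal{L}}:\mathcal{L}\to(\omega,<)$ the unique isomorphism, set $f^{\mathcal{L}}=\pi_{\mathcal{L}}^{-1}\circ f\circ\pi_{\mathcal{L}}$. The degree spectrum relative to $X$ is $\mathrm{DgSp}^X(f)=\{\deg_T(f^{\mathcal{L}}\oplus X):\mathcal{L}\text{ an }X\text{-computable copy of }(\omega,<)\}$. $f$ is intrinsically computable on a cone if there is $X$ with $\mathrm{DgSp}^Y(f)=\{\deg_T(Y)\}$ for all $Y\ge_T X$; $f$ is intrinsically of c.e. degree on a cone if there is $X$ such that for all $Y\ge_T X$ every element of $\mathrm{DgSp}^Y(f)$ is of the form $\deg_T(A\oplus Y)$ with $A$ c.e. in $Y$. A function $f:\omega\to\omega$ is a block function if every $n$ lies in a finite interval $[a,b]$ with $f([a,b])\subseteq[a,b]$ and $f^{-1}([a,b])\subseteq[a,b]$; the minimal such interval is the $f$-block of $n$ (the $f$-blocks partition $\omega$). An $f$-block $B$ embeds into an $f$-block $C$ if there is an order-preserving injection $h:B\to C$ with $h(f(x))=f(h(x))$ for all $x\in B$; $C$ is later than $B$ if all elements of $C$ exceed all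 elements of $B$. *)

(* Defs.v *)
From Stdlib Require Cantor.
From mathcomp Require Import all_boot.
From mathcomp Require Import boolp classical_sets functions cardinality.

Set Implicit Arguments.
Unset Strict Implicit.
Unset Printing Implicit Defensive.

Local Open Scope classical_set_scope.

(* Partial recursive functions relative to an oracle, presented as unary
   functions: several arguments are packed with [Cantor.to_nat].
   There is no identity program: [Pair Fst Snd] computes it. *)
Inductive code : Type :=
  | Zero | Succ | Fst | Snd | Oracle
  | Pair of code & code
  | Comp of code & code
  | Prec of code & code
  | Mu of code.

(* [eval X c n m]: the program [c] with oracle [X] converges on [n] to [m].
   - [Prec c d] maps <a, 0> to c(a) and <a, k+1> to d(<a, <k, r>>) where r is
     its value at <a, k>;
   - [Mu c] maps n to the least m with c(<n, m>) = 0, provided c(<n, k>)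
     converges for all k < m. *)
Fixpoint eval (X : set nat) (c : code) (n m : nat) {struct c} : Prop :=
  match c with
  | Zero => m = 0
  | Succ => m = n.+1
  | Fst => m = (Cantor.of_nat n).1
  | Snd => m = (Cantor.of_nat n).2
  | Oracle => (X n /\ m = 1) \/ (~ X n /\ m = 0)
  | Pair c d =>
      exists u v, [/\ eval X c n u, eval X d n v & m = Cantor.to_nat (u, v)]
  | Comp c d => exists2 u, eval X d n u & eval X c u m
  | Prec c d =>
      let a := (Cantor.of_nat n).1 in
      (fix rec (k r : nat) {struct k} : Prop :=
         match k with
         | 0 => eval X c a r
         | k'.+1 => exists2 u, rec k' u &
             eval X d (Cantor.to_nat (a, Cantor.to_nat (k', u))) r
         end) (Cantor.of_nat n).2 m
  | Mu c =>
      eval X c (Cantor.to_nat (n, m)) 0 /\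
      forall k, k < m -> exists u, eval X c (Cantor.to_nat (n, k)) u.+1
  end.

Definition turing_le (A X : set nat) : Prop :=
  exists c, forall n, (A n -> eval X c n 1) /\ (~ A n -> eval X c n 0).

Definition turing_equiv (A B : set nat) : Prop :=
  turing_le A B /\ turing_le B A.

Definition ce_in (A Y : set nat) : Prop :=
  exists c, A = [set n | exists m, eval Y c n m].

Definition join (A B : set nat) : set nat :=
  [set n | (exists2 k, A k & n = k.*2) \/ (exists2 k, B k & n = k.*2.+1)].

Definition degree : Type := set (set nat).

Definition deg (A : set nat) : degree := [set B | turing_equiv A B].

Definition rel_code (R : nat -> nat -> Prop) : set nat :=
  [set z | exists x y, R x y /\ z = Cantor.to_nat (x, y)].

Definition linear_order (L : set nat) (prec : nat -> nat -> Prop) : Prop :=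
  [/\ forall x y, prec x y -> L x /\ L y,
      forall x, ~ prec x x,
      forall x y z, prec x y -> prec y z -> prec x z &
      forall x y, L x -> L y -> [\/ prec x y, x = y | prec y x]].

(* Only the values of [pi] on [L] are relevant. *)
Definition is_iso (L : set nat) (prec : nat -> nat -> Prop) (pi : nat -> nat) :
    Prop :=
  set_bij L [set: nat] pi /\
  forall x y, L x -> L y -> (prec x y <-> pi x < pi y).

Definition computable_order (X L : set nat) (prec : nat -> nat -> Prop) : Prop :=
  turing_le L X /\ turing_le (rel_code prec) X.

(* The function f^L = pi^-1 \o f \o pi : L -> L, as a set of naturals through
   its graph; L is computable in the base oracle wherever this is used, so its
   degree joined with that oracle does not depend on this choice. *)
Definition transfer (f : nat -> nat) (L : set nat) (pi : nat -> nat) : set nat :=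
  rel_code (fun x y => [/\ L x, L y & pi y = f (pi x)]).

Definition DgSp (X : set nat) (f : nat -> nat) : set degree :=
  [set d | exists (L : set nat) (prec : nat -> nat -> Prop) (pi : nat -> nat),
    [/\ linear_order L prec, is_iso L prec pi, computable_order X L prec &
        d = deg (join (transfer f L pi) X)]].

Definition intrinsically_computable_on_cone (f : nat -> nat) : Prop :=
  exists X : set nat, forall Y : set nat, turing_le X Y ->
    DgSp Y f = [set deg Y].

Definition intrinsically_ce_degree_on_cone (f : nat -> nat) : Prop :=
  exists X : set nat, forall Y : set nat, turing_le X Y ->
    forall d, DgSp Y f d -> exists2 A, ce_in A Y & d = deg (join A Y).

Definition closed_interval (f : nat -> nat) (I : set nat) : Prop :=
  (exists a b, I = [set n | a <= n <= b]) /\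
  f @` I `<=` I /\ f @^-1` I `<=` I.

Definition block_function (f : nat -> nat) : Prop :=
  forall n, exists2 I, closed_interval f I & I n.

Definition is_block_of (f : nat -> nat) (n : nat) (B : set nat) : Prop :=
  [/\ closed_interval f B, B n &
      forall I, closed_interval f I -> I n -> B `<=` I].

Definition is_block (f : nat -> nat) (B : set nat) : Prop :=
  exists n, is_block_of f n B.

Definition embeds (f : nat -> nat) (B C : set nat) : Prop :=
  exists h : nat -> nat,
    [/\ forall x, B x -> C (h x),
        forall x y, B x -> B y -> x < y -> h x < h y &
        forall x, B x -> h (f x) = f (h x)].

Definition later (C B : set nat) : Prop :=
  forall x y, B x -> C y -> x < y.

(* Main.v *)
Require Import Defs.
From Stdlib Require Cantor.
From mathcomp Require Import all_boot order.
From mathcomp Require Import boolp classical_sets functions cardinality.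
From mathcomp Require Import zify.

(* For a copy L computed by Y, the isomorphism to (omega, <) has, over Y, the
   degree of the set A of the pairs <x, s> such that some y >= s lies below x in
   L, and A is c.e. in Y.

   If infinitely many blocks do not embed into a later one, f^L computes the
   isomorphism: once some stage shows a copy of such a block B, preceded by as
   many elements as B is in omega, no element can enter below it any more, as B
   would then have embedded into a later block. So f^L has the degree of A.

   Otherwise all blocks beyond some point can be moved arbitrarily far. A copy
   generic for finite conditions has no c.e. degree: a change of f^L forces a
   new element into a putative c.e. set of the same degree, and moving blocks
   further out undoes the change of f^L while keeping the order, hence also the
   new element. Such a change is available unless f is eventually the identity,
   in which case f is intrinsically computable. *)

Set Implicit Arguments.
Unset Strict Implicit.
Unset Printing Implicit Defensive.

Local Open Scope classical_set_scope.

Local Notation enc x y := (Cantor.to_nat (x, y)).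
Local Notation pi1 z := ((Cantor.of_nat z).1).
Local Notation pi2 z := ((Cantor.of_nat z).2).
Local Arguments Cantor.to_nat : simpl never.
Local Arguments Cantor.of_nat : simpl never.

(** * Pairing and bounded uniformity *)

Lemma enc1 x y : pi1 (enc x y) = x.
Proof. by rewrite Cantor.cancel_of_to. Qed.

Lemma enc2 x y : pi2 (enc x y) = y.
Proof. by rewrite Cantor.cancel_of_to. Qed.

Definition encK := (enc1, enc2).

Lemma encP z : z = enc (pi1 z) (pi2 z).
Proof. by rewrite -surjective_pairing Cantor.cancel_to_of. Qed.

Lemma pi_le z : pi1 z <= z /\ pi2 z <= z.
Proof.
have := Cantor.to_nat_non_decreasing (pi1 z) (pi2 z).
by rewrite -encP; lia.
Qed.

Lemma rel_codeE R z : rel_code R z <-> R (pi1 z) (pi2 z).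
Proof.
split=> [[x [y [Rxy ->]]]|Rz]; first by rewrite !encK.
by exists (pi1 z), (pi2 z); split=> //; apply: encP.
Qed.

(** Merges finitely many bounds, such as uses of computations, into one by taking maxima. *)
Lemma bounded_uniform (P : nat -> nat -> Prop) m :
  (forall k u v, u <= v -> P k u -> P k v) ->
  (forall k, k < m -> exists u, P k u) -> exists u, forall k, k < m -> P k u.
Proof.
move=> Pmon; elim: m => [|m IHm] Pm; first by exists 0.
have [|u Pu] := IHm; first by move=> k km; apply: Pm; apply: ltnW.
have [v Pv] := Pm m (ltnSn m).
exists (maxn u v) => k; rewrite ltnS leq_eqVlt => /orP[/eqP->|km].
  exact: Pmon (leq_maxr _ _) Pv.
exact: Pmon (leq_maxl _ _) (Pu _ km).
Qed.

(** * Oracle computations *)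

(** Names the anonymous recursion inside [eval], so that inductions on the counter can be stated. *)
Definition prec_rel (C D : nat -> nat -> Prop) (a : nat) :=
  fix rec (k r : nat) {struct k} : Prop :=
    match k with
    | 0 => C a r
    | k'.+1 => exists2 u, rec k' u & D (enc a (enc k' u)) r
    end.

Lemma eval_Prec X c d n m :
  eval X (Prec c d) n m =
  prec_rel (eval X c) (eval X d) (pi1 n) (pi2 n) m.
Proof. by []. Qed.

Lemma eval_functional X c n m m' : eval X c n m -> eval X c n m' -> m = m'.
Proof.
elim: c n m m' => [||||| c IHc d IHd | c IHc d IHd | c IHc d IHd | c IHc] n m m'.
- by move=> /= -> ->.
- by move=> /= -> ->.
- by move=> /= -> ->.
- by move=> /= -> ->.
- by move=> /= [[Xn ->]|[Xn ->]] [[Xn' ->]|[Xn' ->]].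
- move=> /= [u [v [cu dv ->]]] [u' [v' [cu' dv' ->]]].
  by rewrite (IHc _ _ _ cu cu') (IHd _ _ _ dv dv').
- move=> /= [u du cu] [u' du']; rewrite -(IHd _ _ _ du du').
  exact: IHc cu.
- rewrite !eval_Prec; elim: (pi2 n) m m' => [|k IHk] m m' /=; first exact: IHc.
  move=> [u ku du] [u' ku']; rewrite -(IHk _ _ ku ku').
  exact: IHd du.
- move=> /= [c0 cS] [c0' cS']; have [lt_m|lt_m|//] := ltngtP m m'.
    by have [u cu] := cS' _ lt_m; have := IHc _ _ _ c0 cu.
  by have [u cu] := cS _ lt_m; have := IHc _ _ _ c0' cu.
Qed.

Definition agree u (A B : set nat) := forall n, n < u -> (A n <-> B n).

Lemma agreeW u v A B : u <= v -> agree v A B -> agree u A B.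
Proof. by move=> uv AB n nu; apply: AB; apply: leq_trans uv. Qed.

Lemma agree_join u A A' B B' :
  agree u A A' -> agree u B B' -> agree u (join A B) (join A' B').
Proof.
move=> AA' BB' n nu; split=> -[] [k Hk nk]; [left|right|left|right];
  by exists k => //; (apply/AA' || apply/BB') => //; lia.
Qed.

(** A convergent computation consults its oracle at finitely many places, and [u] lies above all of
    them. *)
Lemma use_principle X c n m :
  eval X c n m -> exists u, forall X', agree u X X' -> eval X' c n m.
Proof.
elim: c n m => [||||| c IHc d IHd | c IHc d IHd | c IHc d IHd | c IHc] n m.
- by exists 0.
- by exists 0.
- by exists 0.
- by exists 0.
- by move=> /= XnP; exists n.+1 => X' XX'; rewrite -(XX' n).
- move=> /= [x [y [/IHc[u cu] /IHd[v dv] ->]]]; exists (maxn u v) => X' XX'.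
  exists x, y; split=> //; [apply: cu | apply: dv]; apply: agreeW XX'; lia.
- move=> /= [x /IHd[v dv] /IHc[u cu]]; exists (maxn u v) => X' XX'.
  exists x; [apply: dv | apply: cu]; apply: agreeW XX'; lia.
- rewrite eval_Prec => H.
  suff [u Hu] : exists u, forall X', agree u X X' ->
      prec_rel (eval X' c) (eval X' d) (pi1 n) (pi2 n) m by exists u.
  elim: (pi2 n) m H => [|k IHk] m /=; first exact: IHc.
  move=> [x /IHk[u ku] /IHd[v dv]]; exists (maxn u v) => X' XX'.
  exists x; [apply: ku | apply: dv]; apply: agreeW XX'; lia.
- move=> /= [/IHc[u c0] cS].
  (* The finitely many computations at arguments below [m] need a common use. *)
  have [||v cv] := @bounded_uniform (fun k v => forall X', agree v X X' ->
      exists w, eval X' c (enc n k) w.+1) m.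
  + by move=> k v w vw H X' XX'; apply: H; apply: agreeW XX'.
  + move=> k /cS[w /IHc[v cv]]; exists v => X' XX'; exists w; exact: cv.
  exists (maxn u v) => X' XX'; split; first by apply: c0; apply: agreeW XX'; lia.
  by move=> k km; apply: cv => //; apply: agreeW XX'; lia.
Qed.

Fixpoint subst_oracle (d c : code) : code :=
  match c with
  | Zero => Zero | Succ => Succ | Fst => Fst | Snd => Snd
  | Oracle => d
  | Pair c1 c2 => Pair (subst_oracle d c1) (subst_oracle d c2)
  | Comp c1 c2 => Comp (subst_oracle d c1) (subst_oracle d c2)
  | Prec c1 c2 => Prec (subst_oracle d c1) (subst_oracle d c2)
  | Mu c1 => Mu (subst_oracle d c1)
  end.

Definition decides X c (A : set nat) :=
  forall n, (A n -> eval X c n 1) /\ (~ A n -> eval X c n 0).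

Lemma eval_subst X d A c n m :
  decides X d A -> eval A c n m -> eval X (subst_oracle d c) n m.
Proof.
move=> dA.
elim: c n m => [||||| c IHc e IHe | c IHc e IHe | c IHc e IHe | c IHc] n m //.
- by move=> /= [[An ->]|[An ->]]; apply dA.
- by move=> /= [x [y [/IHc cx /IHe ey ->]]]; exists x, y.
- by move=> /= [x /IHe ex /IHc cx]; exists x.
- rewrite [subst_oracle _ _]/= !eval_Prec.
  elim: (pi2 n) m => [|k IHk] m /=; first exact: IHc.
  by move=> [x /IHk kx /IHe ex]; exists x.
- move=> /= [/IHc c0 cS]; split=> // k /cS[u /IHc cu]; by exists u.
Qed.

(** * Closure properties of the computable functions *)

(** Predicates are covered too, as boolean functions coerced to 0 and 1. *)
Definition computable Y (g : nat -> nat) := exists c, forall n, eval Y c n (g n).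

Definition char (A : set nat) (n : nat) : bool := `[< A n >].

Lemma turing_leE A Y : turing_le A Y <-> computable Y (char A).
Proof.
split=> -[c cA]; exists c => n.
  by rewrite /char; case: asboolP => An; apply cA.
by split=> An; have := cA n; rewrite /char; case: asboolP.
Qed.

Lemma computable_ext Y g h : g =1 h -> computable Y g -> computable Y h.
Proof. by move=> /funext->. Qed.

Lemma computable_trans A Y g : turing_le A Y -> computable A g -> computable Y g.
Proof.
by move=> [d dA] [c cg]; exists (subst_oracle d c) => n; apply: eval_subst dA _.
Qed.

Lemma turing_le_trans A B C : turing_le A B -> turing_le B C -> turing_le A C.
Proof. by rewrite !turing_leE => AB /turing_leE BC; apply: computable_trans AB. Qed.

Lemma turing_le_refl A : turing_le A A.
Proof. by exists Oracle => n; split=> An; [left|right]. Qed.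

Lemma turing_equiv_refl A : turing_equiv A A.
Proof. by split; apply: turing_le_refl. Qed.

Lemma deg_eqP A B : deg A = deg B <-> turing_equiv A B.
Proof.
split=> [AB|[AB BA]].
  by have [AA' BA] : deg B A by rewrite -AB; apply: turing_equiv_refl.
rewrite /deg; apply/seteqP; split=> C [AC CA]; split.
- exact: turing_le_trans BA AC.
- exact: turing_le_trans CA AB.
- exact: turing_le_trans AB AC.
- exact: turing_le_trans CA BA.
Qed.

Lemma computable_comp Y g h :
  computable Y g -> computable Y h -> computable Y (g \o h).
Proof. by move=> [c cg] [d dh]; exists (Comp c d) => n; exists (h n). Qed.

Lemma computable_char A Y g :
  turing_le A Y -> computable Y g -> computable Y (fun n => char A (g n)).
Proof. by move=> /turing_leE AY Yg; apply: computable_comp AY Yg. Qed.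

Lemma computable_enc Y g h :
  computable Y g -> computable Y h -> computable Y (fun n => enc (g n) (h n)).
Proof.
by move=> [c cg] [d dh]; exists (Pair c d) => n; exists (g n), (h n).
Qed.

Lemma computable_pi1 Y g : computable Y g -> computable Y (fun n => pi1 (g n)).
Proof. by apply: (@computable_comp Y (fun n => pi1 n)); exists Fst. Qed.

Lemma computable_pi2 Y g : computable Y g -> computable Y (fun n => pi2 (g n)).
Proof. by apply: (@computable_comp Y (fun n => pi2 n)); exists Snd. Qed.

Lemma computable_succ Y g : computable Y g -> computable Y (fun n => (g n).+1).
Proof. by apply: (@computable_comp Y (fun n => n.+1)); exists Succ. Qed.

Lemma computable_id Y : computable Y id.
Proof.
apply: (@computable_ext Y (fun n => enc (pi1 n) (pi2 n))).
  by move=> n; rewrite -encP.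
by apply: computable_enc; [exists Fst | exists Snd].
Qed.

Lemma computable_const Y k : computable Y (fun=> k).
Proof.
by elim: k => [|k IHk]; [exists Zero | apply: computable_succ IHk].
Qed.

Lemma computable_rec Y (g k : nat -> nat) (h : nat -> nat -> nat -> nat) :
  computable Y g -> computable Y k ->
  computable Y (fun z => h (pi1 z) (pi1 (pi2 z)) (pi2 (pi2 z))) ->
  computable Y (fun n => nat_rect (fun=> nat) (g n) (h n) (k n)).
Proof.
move=> [c cg] Yk [d dh].
pose r z := nat_rect (fun=> nat) (g (pi1 z)) (h (pi1 z)) (pi2 z).
(* [Prec] acts on a pair of parameter and counter, so the argument is first paired with its
   bound. *)
apply: (@computable_ext Y (r \o (fun n => enc n (k n)))).
  by move=> n; rewrite /r /= !encK.
apply: computable_comp; last exact: computable_enc (computable_id Y) Yk.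
exists (Prec c d) => z; rewrite eval_Prec /r.
elim: (pi2 z) => [|i IHi] /=; first exact: cg.
eexists; first exact: IHi.
set u := nat_rect _ _ _ _.
by have := dh (enc (pi1 z) (enc i u)); rewrite !encK.
Qed.

Lemma computable_if Y (b : nat -> bool) g h :
  computable Y b -> computable Y g -> computable Y h ->
  computable Y (fun n => if b n then g n else h n).
Proof.
move=> Yb Yg Yh.
(* The condition, read as 0 or 1, is the number of recursion steps. *)
apply: (@computable_ext Y
  (fun n => nat_rect (fun=> nat) (h n) (fun _ _ => g n) (b n))).
  by move=> n; case: (b n).
apply: (@computable_rec Y h b (fun n _ _ => g n)) => //.
exact: (computable_comp Yg (computable_pi1 (computable_id Y))).
Qed.

Lemma computable_and Y (b c : nat -> bool) :
  computable Y b -> computable Y c -> computable Y (fun n => b n && c n).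
Proof.
move=> Yb Yc.
apply: (@computable_ext Y (fun n => if b n then c n : nat else 0)).
  by move=> n; case: (b n).
by apply: computable_if => //; apply: computable_const.
Qed.

Lemma computable_neg Y (b : nat -> bool) :
  computable Y b -> computable Y (fun n => ~~ b n).
Proof.
move=> Yb.
apply: (@computable_ext Y (fun n => if b n then 0 else 1)).
  by move=> n; case: (b n).
by apply: computable_if => //; apply: computable_const.
Qed.

Lemma computable_or Y (b c : nat -> bool) :
  computable Y b -> computable Y c -> computable Y (fun n => b n || c n).
Proof.
move=> Yb Yc.
apply: (@computable_ext Y (fun n => ~~ (~~ b n && ~~ c n))).
  by move=> n; case: (b n); case: (c n).
by apply: computable_neg; apply: computable_and; apply: computable_neg.
Qed.

Lemma computable_pred Y g : computable Y g -> computable Y (fun n => (g n).-1).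
Proof.
move=> Yg.
apply: (@computable_ext Y
  (fun n => nat_rect (fun=> nat) 0 (fun i _ => i) (g n))).
  by move=> n; case: (g n).
apply: (@computable_rec Y (fun=> 0) g (fun _ i _ => i)) => //.
  exact: computable_const.
exact: computable_pi1 (computable_pi2 (computable_id Y)).
Qed.

Lemma computable_sub Y g h :
  computable Y g -> computable Y h -> computable Y (fun n => g n - h n).
Proof.
move=> Yg Yh.
apply: (@computable_ext Y
  (fun n => nat_rect (fun=> nat) (g n) (fun _ r => r.-1) (h n))).
  by move=> n; elim: (h n) => [|k IHk] /=; [lia | rewrite IHk; lia].
apply: (@computable_rec Y g h (fun _ _ r => r.-1)) => //.
exact: computable_pred (computable_pi2 (computable_pi2 (computable_id Y))).
Qed.

Lemma computable_add Y g h :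
  computable Y g -> computable Y h -> computable Y (fun n => g n + h n).
Proof.
move=> Yg Yh.
apply: (@computable_ext Y
  (fun n => nat_rect (fun=> nat) (g n) (fun _ r => r.+1) (h n))).
  by move=> n; elim: (h n) => [|k IHk] /=; [lia | rewrite IHk; lia].
apply: (@computable_rec Y g h (fun _ _ r => r.+1)) => //.
exact: computable_succ (computable_pi2 (computable_pi2 (computable_id Y))).
Qed.

Lemma computable_eq0 Y g : computable Y g -> computable Y (fun n => g n == 0).
Proof.
move=> Yg; apply: (@computable_ext Y (fun n => 1 - g n)).
  by move=> n; case: (g n).
by apply: computable_sub => //; apply: computable_const.
Qed.

Lemma computable_leq Y g h :
  computable Y g -> computable Y h -> computable Y (fun n => g n <= h n).
Proof. by move=> Yg Yh; apply: computable_eq0; apply: computable_sub. Qed.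

Lemma computable_ltn Y g h :
  computable Y g -> computable Y h -> computable Y (fun n => g n < h n).
Proof. by move=> Yg Yh; apply: computable_leq => //; apply: computable_succ. Qed.

Lemma computable_eqn Y g h :
  computable Y g -> computable Y h -> computable Y (fun n => g n == h n).
Proof.
move=> Yg Yh; apply: (@computable_ext Y (fun n => (g n <= h n) && (h n <= g n))).
  by move=> n; rewrite eqn_leq.
by apply: computable_and; apply: computable_leq.
Qed.

Lemma computable_all Y (k : nat -> nat) (b : nat -> nat -> bool) :
  computable Y k -> computable Y (fun z => b (pi1 z) (pi2 z)) ->
  computable Y (fun n => all (b n) (iota 0 (k n))).
Proof.
move=> Yk Yb.
apply: (@computable_ext Y
  (fun n => nat_rect (fun=> nat) 1 (fun i r => (r == 1) && b n i) (k n))).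
  move=> n; elim: (k n) => // j IHj.
  rewrite -[in RHS]addn1 iotaD all_cat /= IHj andbT.
  by case: (all _ _).
apply: (@computable_rec Y (fun=> 1) k
  (fun n i r => ((r == 1) && b n i))) => //; first exact: computable_const.
apply: computable_and.
  apply: computable_eqn; last exact: computable_const.
  exact: computable_pi2 (computable_pi2 (computable_id Y)).
pose e z := enc (pi1 z) (pi1 (pi2 z)).
apply: (@computable_ext Y ((fun z => b (pi1 z) (pi2 z) : nat) \o e)).
  by move=> z; rewrite /e /= !encK.
apply: computable_comp => //; apply: computable_enc.
  exact: computable_pi1 (computable_id Y).
exact: computable_pi1 (computable_pi2 (computable_id Y)).
Qed.

Lemma computable_count Y (k : nat -> nat) (b : nat -> nat -> bool) :
  computable Y k -> computable Y (fun z => b (pi1 z) (pi2 z)) ->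
  computable Y (fun n => count (b n) (iota 0 (k n))).
Proof.
move=> Yk Yb.
apply: (@computable_ext Y
  (fun n => nat_rect (fun=> nat) 0 (fun i r => r + b n i) (k n))).
  move=> n; elim: (k n) => // j IHj.
  by rewrite -[in RHS]addn1 iotaD count_cat /= IHj addn0.
apply: (@computable_rec Y (fun=> 0) k (fun n i r => r + b n i)) => //.
  exact: computable_const.
apply: computable_add.
  exact: computable_pi2 (computable_pi2 (computable_id Y)).
pose e z := enc (pi1 z) (pi1 (pi2 z)).
apply: (@computable_ext Y ((fun z => b (pi1 z) (pi2 z) : nat) \o e)).
  by move=> z; rewrite /e /= !encK.
apply: computable_comp => //; apply: computable_enc.
  exact: computable_pi1 (computable_id Y).
exact: computable_pi1 (computable_pi2 (computable_id Y)).
Qed.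

Lemma computable_search Y (b : nat -> nat -> bool) :
  computable Y (fun z => b (pi1 z) (pi2 z)) -> (forall n, exists m, b n m) ->
  exists2 g, computable Y g & forall n, b n (g n).
Proof.
(* [Mu] looks for a zero, hence the negation of [b]. *)
move=> /computable_neg[c cb] exb.
exists (fun n => ex_minn (exb n)); last by move=> n; case: ex_minnP.
exists (Mu c) => n; case: ex_minnP => m bm mmin; split.
  by have := cb (enc n m); rewrite !encK bm.
move=> k km; exists 0; have := cb (enc n k); rewrite !encK.
by case: (boolP (b n k)) => // /mmin; rewrite leqNgt km.
Qed.

Lemma ce_exists Y (b : nat -> nat -> bool) :
  computable Y (fun z => b (pi1 z) (pi2 z)) -> ce_in [set n | exists m, b n m] Y.
Proof.
move=> /computable_neg[c cb]; exists (Mu c); apply/seteqP; split=> n /=.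
  move=> exb; exists (ex_minn exb); case: ex_minnP => m bm mmin; split.
    by have := cb (enc n m); rewrite !encK bm.
  move=> k km; exists 0; have := cb (enc n k); rewrite !encK.
  by case: (boolP (b n k)) => // /mmin; rewrite leqNgt km.
move=> [m [c0 _]]; exists m; have := cb (enc n m); rewrite !encK => /eval_functional.
by move/(_ _ c0); case: (b n m).
Qed.

(** * Joins *)

Lemma join_double A B k : join A B k.*2 <-> A k.
Proof.
split=> [[[j Aj]|[j _]]|Ak]; [|lia|by left; exists k].
by move=> kj; have -> : k = j by lia.
Qed.

Lemma join_doubleS A B k : join A B k.*2.+1 <-> B k.
Proof.
split=> [[[j _]|[j Bj]]|Bk]; [lia| |by right; exists k].
by move=> kj; have -> : k = j by lia.
Qed.

Lemma turing_le_joinl A B : turing_le A (join A B).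
Proof.
apply/turing_leE; apply: (@computable_ext _ (fun n => char (join A B) (n + n))).
  by move=> n; rewrite /char addnn; congr nat_of_bool; apply: asbool_equiv_eq;
     apply: join_double.
apply: computable_char (turing_le_refl _) _.
by apply: computable_add; apply: computable_id.
Qed.

Lemma turing_le_joinr A B : turing_le B (join A B).
Proof.
apply/turing_leE; apply: (@computable_ext _ (fun n => char (join A B) (n + n).+1)).
  by move=> n; rewrite /char addnn; congr nat_of_bool; apply: asbool_equiv_eq;
     apply: join_doubleS.
apply: computable_char (turing_le_refl _) _.
by apply: computable_succ; apply: computable_add; apply: computable_id.
Qed.

Lemma turing_le_join A B Y : turing_le A Y -> turing_le B Y -> turing_le (join A B) Y.
Proof.
move=> AY BY.
have Yodd : computable Y odd.
  apply: (@computable_ext Y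
    (fun n => nat_rect (fun=> nat) 0 (fun _ r => r == 0) n)).
    by elim=> //= n ->; case: (odd n).
  apply: (@computable_rec Y (fun=> 0) id (fun _ _ r => r == 0)).
  - exact: computable_const.
  - exact: computable_id.
  - exact: computable_eq0 (computable_pi2 (computable_pi2 (computable_id Y))).
have Yhalf : computable Y half.
  apply: (@computable_ext Y
    (fun n => nat_rect (fun=> nat) 0 (fun i r => r + odd i) n)).
    by elim=> //= n ->; rewrite uphalf_half addnC.
  apply: (@computable_rec Y (fun=> 0) id (fun _ i r => r + odd i)).
  - exact: computable_const.
  - exact: computable_id.
  - apply: computable_add.
      exact: computable_pi2 (computable_pi2 (computable_id Y)).
    apply: (computable_comp Yodd).
    exact: computable_pi1 (computable_pi2 (computable_id Y)).
apply/turing_leE; apply: (@computable_ext Y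
  (fun n => if odd n then char B n./2 : nat else char A n./2)); last first.
  by apply: computable_if => //; apply: computable_char.
move=> n; rewrite -[in RHS](odd_double_half n).
by case: (odd n); rewrite /char ?add1n ?add0n; congr nat_of_bool;
   apply/esym/asbool_equiv_eq; [apply: join_doubleS | apply: join_double].
Qed.

(** * Blocks *)

(** The equality of booleans says at once that [0, m) is closed under [f] and under preimages. *)
Definition cut (f : nat -> nat) m := forall x, (f x < m) = (x < m).

(* The blocks of the paper's partition. With the literal definition of
   [is_block], a block may be nested inside another one, as [1, 1] inside
   [0, 2] when f exchanges 0 and 2 and fixes 1; a [cut_pair] delimits a block
   that is maximal for inclusion. *)
Definition cut_pair (f : nat -> nat) c d :=
  [/\ cut f c, cut f d, c < d & forall m, cut f m -> c < m -> d <= m].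

(** No target block is named: for a cut pair, [emb_below_cut] will confine the image to the block
    that contains its first point. *)
Definition emb (f : nat -> nat) a b (e : nat -> nat) :=
  (forall i j, a <= i -> i < j -> j < b -> e i < e j) /\
  (forall i, a <= i < b -> e (f i) = f (e i)).

Definition movable f c d := exists2 e, emb f c d e & d <= e c.

Definition non_embedding_blocks f := [set B : set nat | is_block f B /\
  ~ exists C, [/\ is_block f C, later C B & embeds f B C]].

Lemma closed_intervalE f I : closed_interval f I -> forall x, I (f x) <-> I x.
Proof.
move=> [_ [fI If]] x; split=> [/If//|Ix]; by apply: fI; exists x.
Qed.

Lemma cut_unbounded f n : block_function f -> exists2 m, n <= m & cut f m.
Proof.
move=> fb; elim: n => [|n [m nm cm]]; first by exists 0.
have [I cI Im] := fb m; have IE := closed_intervalE cI.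
have [[a [b defI]] _] := cI; rewrite defI /= in Im IE.
(* The union of [0, m) and [a, b] is [0, b + 1), as [m] lies in [a, b]. *)
exists b.+1; first by lia.
by move=> x; have := cm x; have := IE x; lia.
Qed.

Lemma cut_interval f c d : cut f c -> cut f d -> c < d ->
  closed_interval f [set n | c <= n <= d.-1].
Proof.
move=> cc cd ltcd; split; first by exists c, d.-1.
split=> [_ [x /= xI <-]|x /=]; have := cc x; have := cd x; lia.
Qed.

(** Take the last cut up to [n], which exists because 0 is a cut, and the first cut beyond [n]. *)
Lemma cut_pair_at f n : block_function f ->
  exists c d, cut_pair f c d /\ c <= n < d.
Proof.
move=> fb; have [m nm cm] := cut_unbounded n.+1 fb.
pose P c := `[< cut f c >] && (c <= n); pose Q d := `[< cut f d >] && (n < d).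
have exP : exists c, P c by exists 0; rewrite /P andbT; apply/asboolP => x.
have exQ : exists d, Q d by exists m; rewrite /Q nm andbT; apply/asboolP.
have ubP c : P c -> c <= n by move=> /andP[].
case: (ex_maxnP exP ubP) => c /andP[/asboolP cc cn] cmax.
case: (ex_minnP exQ) => d /andP[/asboolP cd nd] dmin.
exists c, d; split; last by rewrite cn.
split=> //; first exact: leq_ltn_trans nd.
move=> k ck ltck; apply: dmin; apply/andP; split; first exact/asboolP.
rewrite ltnNge; apply/negP => kn; move: ltck; rewrite ltnNge cmax //.
by apply/andP; split=> //; apply/asboolP.
Qed.

(** The left end is the point to look at: a closed interval [a, b] around the cut [c] makes b + 1 a
    cut, hence reaches [d]. Inner points may have smaller blocks. *)
Lemma cut_pair_block f c d : block_function f -> cut_pair f c d ->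
  is_block_of f c [set n | c <= n <= d.-1].
Proof.
move=> fb [cc cd ltcd dmin]; split; first exact: cut_interval.
  by rewrite /=; lia.
move=> I cI Ic; have IE := closed_intervalE cI.
have [[a [b defI]] _] := cI; rewrite defI /= in Ic IE *.
suff cb : cut f b.+1 by have := dmin _ cb; rewrite /=; move=> ? x /=; lia.
by move=> x; have := cc x; have := IE x; lia.
Qed.

Lemma block_sub_cut_pair f c d n B : cut_pair f c d -> c <= n < d ->
  is_block_of f n B -> B `<=` [set n | c <= n <= d.-1].
Proof.
move=> [cc cd ltcd _] nI [_ _]; apply; first exact: cut_interval.
by rewrite /=; lia.
Qed.

(* The points mapped below d' form an initial segment of [c, d) that is closed
   under f and its inverse, so its end is a cut. *)
Lemma emb_below_cut f c d d' e : cut_pair f c d -> cut f d' -> emb f c d e ->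
  e c < d' -> forall i, c <= i < d -> e i < d'.
Proof.
move=> [cc cd ltcd dmin] cd' [emon ecomm] ec.
case: (pselect (forall i, c <= i < d -> e i < d')) => //= nall i iI.
have exj : exists j, (c <= j < d) && (d' <= e j).
  have /existsNP[j /not_implyP[jI ej]] := nall.
  by exists j; rewrite jI leqNgt; apply/negP.
case: (ex_minnP exj) => m /andP[mI em] mmin.
have mP x : c <= x < d -> (e x < d') = (x < m).
  move=> xI; apply/idP/idP => [ex|xm].
    rewrite ltnNge; apply/negP => mx; move: ex; rewrite ltnNge => /negP; apply.
    apply: leq_trans em _; move: mx; rewrite leq_eqVlt => /orP[/eqP->//|mx].
    by apply/ltnW/emon => //; lia.
  by rewrite ltnNge; apply/negP => ex; have := mmin x; rewrite xI ex; lia.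
have : cut f m; last first.
  have ltcm : c < m by rewrite -mP //; lia.
  by move=> cm; have := dmin m cm ltcm; lia.
move=> x; have := cc x; have := cd x.
have [xI|] := boolP (c <= x < d); last by lia.
move=> fxd fxc; have fxI : c <= f x < d by lia.
by rewrite -!mP // ecomm //.
Qed.

(** Stated for any [B] inside the pair, to include nested blocks. The cut pair around [e c] starts
    at [d] or later because [d] is a cut, and it contains the whole image. *)
Lemma movable_embeds f c d B : block_function f -> cut_pair f c d ->
  movable f c d -> B `<=` [set n | c <= n <= d.-1] ->
  exists C, [/\ is_block f C, later C B & embeds f B C].
Proof.
move=> fb cp [e [emon ecomm] dec] Bsub.
have [c' [d' [cp' ecI]]] := cut_pair_at (e c) fb.
have [cc' cd' ltcd' _] := cp'; have [cc cd ltcd _] := cp.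
have below := emb_below_cut cp cd' (conj emon ecomm).
have ledc' : d <= c'.
  by case: cp' => _ _ _ dmin'; rewrite leqNgt; apply/negP => /(dmin' _ cd); lia.
have BI x : B x -> c <= x < d by move=> /Bsub /=; lia.
exists [set n | c' <= n <= d'.-1]; split.
- by exists c'; apply: cut_pair_block.
- by move=> x y /BI xI /= yI; lia.
- exists e; split=> [x /BI xI /=|x y /BI xI /BI yI xy|x /BI xI].
  + have ex : e x < d' by apply: below; lia.
    suff : e c <= e x by lia.
    have [->//|xc] := eqVneq x c.
    by apply/ltnW/emon; lia.
  + by apply: emon; lia.
  + exact: ecomm.
Qed.

Lemma embeds_movable f c d C : cut_pair f c d ->
  later C [set n | c <= n <= d.-1] -> embeds f [set n | c <= n <= d.-1] C ->
  movable f c d.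
Proof.
move=> [_ _ ltcd _] lCB [h [hC hmon hcomm]]; exists h.
  split=> [i j ci ij jd|i iI]; last by apply: hcomm; rewrite /=; lia.
  by apply: hmon => //=; lia.
suff : d.-1 < h c by lia.
by apply: lCB; [rewrite /=; lia | apply: hC; rewrite /=; lia].
Qed.

Lemma finite_intervals N : finite_set
  [set B : set nat | exists a b, [/\ B = [set n | a <= n <= b], a < N & b < N]].
Proof.
apply: (@sub_finite_set _ _
  [set [set n | a <= n <= b] | a in `I_N & b in `I_N]).
  by move=> B [a [b [-> aN bN]]]; exists a => //; exists b.
by apply: finite_image2; apply: finite_II.
Qed.

(** Were all pairs from [N] on movable, every non-embedding block would lie below a fixed cut [M],
    which leaves room for finitely many intervals only. *)
Lemma infinite_non_movable f : block_function f ->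
  infinite_set (non_embedding_blocks f) ->
  forall N, exists c d, [/\ cut_pair f c d, N <= c & ~ movable f c d].
Proof.
move=> fb inf N; have [M NM cM] := cut_unbounded N fb.
apply: contrapT => nex; apply: inf.
apply: sub_finite_set (finite_intervals M) => B [[n Bn] Bbad].
have [c [d [cp nI]]] := cut_pair_at n fb.
have Bsub := block_sub_cut_pair cp nI Bn.
have [[[a [b defB]] _] nB _] := Bn.
have lecM : d <= M.
  have [_ _ _ dmin] := cp; apply: dmin => //; rewrite ltnNge; apply/negP => Mc.
  apply: nex; exists c, d; split=> //; first exact: leq_trans Mc.
  by move=> mov; apply: Bbad; apply: movable_embeds cp mov Bsub.
rewrite defB /= in nB Bsub.
have /= := Bsub a; have /= := Bsub b.
by exists a, b; split=> //; lia.
Qed.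

Lemma finite_set_bounded (A : set nat) :
  finite_set A -> exists N, forall n, A n -> n < N.
Proof.
move=> /finite_seqP[s ->]; exists (\max_(i <- s) i).+1 => n /= ns.
by rewrite ltnS; apply: leq_bigmax_seq.
Qed.

Lemma finite_movable f : block_function f ->
  finite_set (non_embedding_blocks f) ->
  exists N, forall c d, cut_pair f c d -> N <= c -> movable f c d.
Proof.
move=> fb fin.
(* The least element; the default 0 concerns only the empty set, which is no block. *)
pose low (B : set nat) := xget 0 [set c | B c /\ forall x, B x -> c <= x].
have [N NP] := finite_set_bounded (finite_image low fin).
exists N => c d cp Nc; apply: contrapT => nmov.
have [_ _ ltcd _] := cp.
suff : c < N by rewrite ltnNge Nc.
apply: NP; exists [set n | c <= n <= d.-1].
  split; first by exists c; apply: cut_pair_block.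
  by move=> [C [_ lC eC]]; apply: nmov; apply: embeds_movable eC.
rewrite /low; apply: xget_unique.
  by split=> /= [|x /andP[]//]; lia.
move=> y [/= yI ymin]; have := ymin c; rewrite /=; lia.
Qed.

(** Embeddings compose: moving the block that contains the image pushes the image at least one
    position further. *)
Lemma emb_far f N : block_function f ->
  (forall c d, cut_pair f c d -> N <= c -> movable f c d) ->
  forall c d K, cut_pair f c d -> N <= c ->
  exists2 e, emb f c d e & K <= e c.
Proof.
move=> fb mov c d K cp Nc; have [cc cd ltcd _] := cp.
elim: K => [|K [e eE Ke]].
  by have [e eE _] := mov c d cp Nc; exists e.
have [emon ecomm] := eE.
have [c' [d' [cp' ecI]]] := cut_pair_at (e c) fb.
have [cc' cd' ltcd' dmin'] := cp'.
have below := emb_below_cut cp cd' eE.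
have [cK|Kc] := leqP K.+1 (e c); first by exists e.
have eI i : c <= i < d -> c' <= e i < d'.
  move=> iI; have -> : e i < d' by apply: below; lia.
  have [->|ic] := eqVneq i c; first by lia.
  by have := emon c i; lia.
(* A target block starting before [N] ends by [c], so the image started before [c] and a single move
   of [c, d) already gains enough. *)
have [lecc'|ltc'c] := leqP N c'; last first.
  have [e' eE' de'] := mov c d cp Nc; exists e' => //.
  by have := dmin' _ cc; lia.
have [e' [emon' ecomm'] de'] := mov c' d' cp' lecc'.
exists (e' \o e).
  split=> [i j ci ij jd|i iI] /=.
    have := eI i; have := eI j; have := emon i j.
    by move=> ? ? ?; apply: emon'; lia.
  by rewrite ecomm // ecomm' // eI.
have [ec|ec] := eqVneq (e c) c'; rewrite /=; first by rewrite ec; lia.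
by have := emon' c' (e c); lia.
Qed.

(** The blocks of [a, b) are placed one after the other, by induction from the last one. *)
Lemma emb_interval_far f N : block_function f ->
  (forall c d, cut_pair f c d -> N <= c -> movable f c d) ->
  forall a b K, cut f a -> cut f b -> N <= a -> a <= b ->
  exists2 e, emb f a b e & forall i, a <= i < b -> K <= e i.
Proof.
move=> fb mov a b K ca cb Na.
elim/ltn_ind: b cb => b IHb cb; rewrite leq_eqVlt => /orP[/eqP->|ltab].
  by exists id => [|i]; [split=> [i j|i]; lia | lia].
have [c [d [cp bI]]] := cut_pair_at b.-1 fb; have [cc cd ltcd dmin] := cp.
have defd : d = b by have := dmin b cb; lia.
rewrite {}defd in cp cd ltcd dmin bI.
have leac : a <= c by rewrite leqNgt; apply/negP => /(dmin _ ca); lia.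
have [e [emon ecomm] eK] := IHb c ltcd cc leac.
(* The last block must land beyond [K] and beyond the largest value used on [a, c), taken at c -
   1. *)
have [e' [emon' ecomm'] eK'] :=
  emb_far fb mov (maxn K (e c.-1).+1) cp (leq_trans Na leac).
have elast i : a <= i -> i < c -> e i <= e c.-1.
  move=> ai ic; have [->//|ine] := eqVneq i c.-1.
  by apply/ltnW/emon; lia.
have efirst i : c <= i -> i < b -> e' c <= e' i.
  move=> ci ib; have [->//|ine] := eqVneq i c.
  by apply/ltnW/emon'; lia.
exists (fun i => if i < c then e i else e' i); last first.
  move=> i iI; case: ltnP => ic; first by apply: eK; lia.
  by have := efirst i; lia.
split=> [i j ai ij jb|i iI].
  case: (ltnP i c) => ic; case: (ltnP j c) => jc; try lia.
  - exact: emon.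
  - by have := elast i ai ic; have := efirst j jc jb; lia.
  - exact: emon'.
have := cc i; case: (ltnP i c) => ic ->; [apply: ecomm | apply: ecomm']; lia.
Qed.

(** * Copies of the natural numbers *)

Lemma iso_inverse L prec pi : is_iso L prec pi -> exists rho,
  [/\ forall n, L (rho n), forall n, pi (rho n) = n &
      forall x, L x -> rho (pi x) = x].
Proof.
move=> [[_ inj surj] _].
have /choice[rho rhoP] : forall n, exists x, L x /\ pi x = n.
  by move=> n; have [x Lx <-] := surj n Logic.I; exists x.
exists rho; split=> [n|n|x Lx]; [by case: (rhoP n)..|].
by have [? ?] := rhoP (pi x); apply: inj; rewrite ?inE.
Qed.

Lemma turing_leT Y : turing_le setT Y.
Proof. by exists (Comp Succ Zero) => n; split=> [_|/(_ Logic.I)//]; exists 0. Qed.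

Lemma bounded_computable S N Y : (forall z, S z -> z < N) -> turing_le S Y.
Proof.
move=> SN; apply/turing_leE.
suff : computable Y (fun n => (n < N) && char S n).
  apply: computable_ext => n; congr nat_of_bool.
  by rewrite /char; case: asboolP => [/SN->|_] //; rewrite andbF.
move: N {SN}; elim=> [|N IHN]; first exact: computable_const.
apply: (@computable_ext Y
  (fun n => if n == N then char S N : nat else (n < N) && char S n)).
  by move=> n; rewrite [n < N.+1]leq_eqVlt eqSS ltnS; case: eqP => [->|].
apply: computable_if => //; last exact: computable_const.
  by apply: computable_eqn; [exact: computable_id | exact: computable_const].
Qed.

(** The transferred function differs from the diagonal of [L] by finite sets: [S] holds its pairs
    whose first position is below [M], and [E] the elements at such positions. *)
Lemma cofinite_identity_computable f L prec pi M Y :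
  (forall x, M <= x -> f x = x) -> is_iso L prec pi -> turing_le L Y ->
  turing_le (transfer f L pi) Y.
Proof.
move=> fid iso LY; have [rho [Lrho rhoK piK]] := iso_inverse iso.
pose S z := pi (pi1 z) < M /\ transfer f L pi z.
have [B SB] : exists B, forall z, S z -> z < B.
  have [||B PB] := @bounded_uniform (fun i u => enc (rho i) (rho (f i)) < u) M.
  - by move=> k u v uv; lia.
  - by move=> k _; exists (enc (rho k) (rho (f k))).+1.
  exists B => z [zM /rel_codeE[L1 L2 eq2]].
  have := PB _ zM.
  by rewrite -eq2 !piK // -encP.
pose E x := L x /\ pi x < M.
have [C EC] : exists C, forall x, E x -> x < C.
  have [||C PC] := @bounded_uniform (fun i u => rho i < u) M.
  - by move=> k u v uv; lia.
  - by move=> k _; exists (rho k).+1.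
  by exists C => x [Lx /PC]; rewrite piK.
apply/turing_leE; apply: (@computable_ext Y (fun z => char S z ||
    (char L (pi1 z) && ((pi1 z == pi2 z) && ~~ char E (pi1 z))))); last first.
  have Yid := computable_id Y.
  apply: computable_or; first exact: computable_char (bounded_computable Y SB) Yid.
  apply: computable_and; first exact: computable_char LY (computable_pi1 Yid).
  apply: computable_and.
    exact: computable_eqn (computable_pi1 Yid) (computable_pi2 Yid).
  apply: computable_neg.
  exact: computable_char (bounded_computable Y EC) (computable_pi1 Yid).
move=> z; congr nat_of_bool; rewrite /char.
apply/idP/asboolP => [/orP[/asboolP[]//|/and3P[/asboolP Lz /eqP zz /asboolP nE]]|Tz].
  apply/rel_codeE; rewrite -zz; split=> //; rewrite fid //.
  by rewrite leqNgt; apply/negP => zM; apply: nE.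
apply/orP; have [zM|Mz] := ltnP (pi (pi1 z)) M; first by left; apply/asboolP.
have [L1 L2 eq2] := (rel_codeE _ _).1 Tz; right; apply/and3P; split.
- exact/asboolP.
- apply/eqP; rewrite -(piK _ L1) -(piK _ L2); congr rho.
  by rewrite eq2 fid.
- by apply/asboolP => -[_]; rewrite ltnNge Mz.
Qed.

Lemma bij_copy (pi : nat -> nat) : bijective pi ->
  linear_order setT (fun x y => pi x < pi y) /\
  is_iso setT (fun x y => pi x < pi y) pi.
Proof.
move=> pibij; split; split=> //.
- by move=> x; rewrite ltnn.
- by move=> x y z; apply: ltn_trans.
- move=> x y _ _; have [xy|yx|xy] := ltngtP (pi x) (pi y);
    [by apply: Or31 | by apply: Or33 | apply: Or32].
  exact: bij_inj xy.
- split=> //; first by move=> x y _ _; apply: bij_inj.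
  by move=> n _; have [g _ gK] := pibij; exists (g n).
Qed.

Lemma eventually_identity_computable f M :
  (forall x, M <= x -> f x = x) -> intrinsically_computable_on_cone f.
Proof.
move=> fid; exists set0 => Y _.
have degY L prec pi : is_iso L prec pi -> turing_le L Y ->
    deg (join (transfer f L pi) Y) = deg Y.
  move=> iso LY; apply/deg_eqP; split; last exact: turing_le_joinr.
  apply: turing_le_join (turing_le_refl Y).
  exact: cofinite_identity_computable fid iso LY.
apply/seteqP; split=> [d [L [prec [pi [_ iso [LY _] ->]]]]|d ->] /=.
  exact: degY iso LY.
(* The standard copy shows that the spectrum is not empty. *)
have [lin iso] := bij_copy (@inv_bij nat id (fun=> erefl)).
exists setT, (fun x y => x < y), id; split=> //; last by rewrite (degY _ _ _ iso (turing_leT Y)).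
split; first exact: turing_leT.
apply/turing_leE.
apply: (@computable_ext Y (fun z => pi1 z < pi2 z)).
  move=> z; congr nat_of_bool; rewrite /char.
  apply/idP/asboolP => [zz|/rel_codeE//].
  by apply/(rel_codeE (fun x y => x < y)).
by apply: computable_ltn; [apply: computable_pi1 | apply: computable_pi2];
  apply: computable_id.
Qed.

(** * A generic copy *)

(** Take [x] moved by [f]. If [f] respected every shift of [x], its values at a large cut [m] and at
    m - 1 would give x <= f x and f x <= x. *)
Lemma shift_changes f M : block_function f ->
  (forall N, exists2 x, N <= x & f x <> x) ->
  exists x k, M <= x /\ f (x + k) <> f x + k.
Proof.
move=> fb nid; have [x Mx fx] := nid M.
exists x; apply: contrapT => nex.
have fS k : f (x + k) = f x + k.
  by apply: contrapT => fk; apply: nex; exists k.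
have [m xm cm] := cut_unbounded (x + f x).+1 fb.
have := cm (x + (m - x)); have := cm (x + (m.-1 - x)); rewrite !fS.
lia.
Qed.

(** Given a bijection right below [N], composing it with the transposition of [tau N] and [e N]
    corrects the value at [N] and keeps the earlier ones. *)
Lemma bij_extend (e : nat -> nat) N :
  (forall i j, i < N -> j < N -> e i = e j -> i = j) ->
  exists2 tau, bijective tau & forall i, i < N -> tau i = e i.
Proof.
elim: N => [|N IHN] einj; first by exists id => //; exists id.
have [|tau taubij taue] := IHN.
  by move=> i j iN jN; apply: einj; apply: ltnW.
pose s x := if x == tau N then e N else if x == e N then tau N else x.
have sK : involutive s.
  move=> x; rewrite /s; case: (eqVneq x (tau N)) => [->|xt].
    by rewrite eqxx; case: eqP => [->|].
  case: (eqVneq x (e N)) => [->|xe]; first by rewrite eqxx.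
  by rewrite (negbTE xt) (negbTE xe).
exists (s \o tau); first exact: bij_comp (inv_bij sK) taubij.
move=> i; rewrite ltnS leq_eqVlt => /orP[/eqP->|iN]; first by rewrite /= /s eqxx.
rewrite /= /s (bij_eq taubij) (ltn_eqF iN) taue //; case: eqP => // ei.
have : i = N by apply: einj => //; apply: ltnW.
by move: iN => /ltn_eqF/eqP.
Qed.

(** The base over which the copy given by [pi] is computable; joining [X] keeps it in the cone. *)
Definition oracle X (pi : nat -> nat) :=
  join X (rel_code (fun x y => pi x < pi y)).

Definition ce_set e Y := [set n | exists m, eval Y e n m].

(** The index and both reductions are explicit, so that countably many such statements exhaust the
    c.e. degrees over the base. *)
Definition same_degree X f e c1 c2 pi :=
  let Y := oracle X pi in let F := transfer f setT pi in
  let A := ce_set e Y in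
  decides (join A Y) c1 (join F Y) /\ decides (join F Y) c2 (join A Y).

(** A bijection [pi] with a bound [N] serves as a finite condition: it fixes the occupants of the
    positions below [N]. *)
Definition extends N (pi pi' : nat -> nat) := forall x, pi x < N -> pi' x = pi x.

Lemma agree_oracle X n pi pi' :
  (forall x y, x < n -> y < n -> (pi x < pi y) = (pi' x < pi' y)) ->
  agree n (oracle X pi) (oracle X pi').
Proof.
move=> ord; apply: agree_join => // z zn; rewrite !rel_codeE.
by have [? ?] := pi_le z; rewrite ord //; lia.
Qed.

Lemma agree_transfer f n pi pi' :
  (forall x y, x < n -> y < n -> (pi y = f (pi x) <-> pi' y = f (pi' x))) ->
  agree n (transfer f setT pi) (transfer f setT pi').
Proof.
move=> eqf z zn; rewrite /transfer !rel_codeE.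
have [? ?] := pi_le z.
have := eqf (pi1 z) (pi2 z); rewrite !(leq_ltn_trans _ zn) //.
by move=> /(_ isT isT)[? ?]; split=> -[_ _ ?]; split; auto.
Qed.

Lemma ce_set_use e Y z : ce_set e Y z ->
  exists u, forall Y', agree u Y Y' -> ce_set e Y' z.
Proof.
by move=> [m /use_principle[u mu]]; exists u => Y' YY'; exists m; apply: mu.
Qed.

Lemma finite_range_bounded (pi : nat -> nat) n :
  exists N, forall x, x < n -> pi x < N.
Proof.
apply: (@bounded_uniform (fun x u => pi x < u)) => [k u v|k _]; first by lia.
by exists (pi k).+1.
Qed.

(* If every extension of the condition (pi, M) had a further extension whose
   copy has c.e. degree via e, c1, c2, take such a pi and shift the positions
   from M on by k, so that f^L changes at one pair: c.e.-ness forces a new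
   element z into A. Then move the blocks of pi further out, which restores f^L
   but keeps the order used to enumerate z: now c2 reads from f^L that z is not
   in A. *)
Lemma generic_step X f e c1 c2 B pi M : block_function f ->
  (forall N, exists2 x, N <= x & f x <> x) ->
  (forall c d, cut_pair f c d -> B <= c -> movable f c d) ->
  bijective pi -> exists pi' N, [/\ bijective pi', extends M pi pi' &
    forall pi'', bijective pi'' -> extends N pi' pi'' ->
      ~ same_degree X f e c1 c2 pi''].
Proof.
move=> fb nid mov pi0bij; apply: contrapT => nex.
(* The negated goal: below the condition (pi, M), the copies with [same_degree] are dense. *)
have dense pi' N : bijective pi' -> extends M pi pi' -> exists pi'',
    [/\ bijective pi'', extends N pi' pi'' & same_degree X f e c1 c2 pi''].
  move=> pi'bij ext; apply: contrapT => nex'; apply: nex; exists pi', N.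
  by split=> // pi'' bij'' ext'' same; apply: nex'; exists pi''.
(* Positions below the cut [M'] will stay fixed; the blocks from [M'] on are movable. *)
have [M' MM' cM] := cut_unbounded (maxn M B) fb.
have [pi0 [{}pi0bij ext0 [D1 D2]]] := dense pi M' pi0bij (fun x _ => erefl).
have {}ext0 : extends M pi pi0 by move=> x xM; apply: ext0; lia.
have [x0 [k [Mx0 fx0]]] := shift_changes M' fb nid.
have [rho piK rhoK] := pi0bij.
set Y := oracle X pi0 in D1 D2; set F := transfer f setT pi0 in D1 D2.
set A := ce_set e Y in D1 D2.
pose q := (enc (rho x0) (rho (f x0))).*2.
have Fq : join F Y q.
  by apply/join_double/rel_codeE; rewrite !encK !rhoK.
have [u u1] := use_principle ((D1 q).1 Fq).
(* For each z < u, [v] bounds the use that enumerates [z] into [A] or, if [z] is not in [A], the use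
   with which [c2] finds this out. *)
have [||v vP] := @bounded_uniform (fun z v =>
    (A z -> forall Y', agree v Y Y' -> ce_set e Y' z) /\
    (~ A z -> forall Z, agree v (join F Y) Z -> eval Z c2 z.*2 0)) u.
- move=> z v v' vv' [Hp Hn]; split=> Az Z YZ; [apply: Hp | apply: Hn] => //;
    exact: agreeW YZ.
- move=> z _; case: (pselect (A z)) => Az.
    by have [v vP] := ce_set_use Az; exists v; split.
  have nJ : ~ join A Y z.*2 by move=> /join_double.
  have [v vP] := use_principle ((D2 z.*2).2 nJ).
  by exists v; split.
pose n := maxn u v.
have [N0 N0P] := finite_range_bounded pi0 n.
have [N NN0 cN] := cut_unbounded (N0 + x0 + M').+1 fb.
have nN x : x < n -> pi0 x < N by move=> /N0P; lia.
(* The shift opens a gap of [k] positions at [M']. As [M'] and [N] are cuts, [x0] and [f x0] are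
   both shifted. *)
pose sigma0 i := if i < M' then i else i + k.
have [|sigma sbij sE] := @bij_extend sigma0 N.
  by move=> i j _ _; rewrite /sigma0; case: ltnP => ?; case: ltnP => ?; lia.
have [||pi2 [pi2bij ext2 [D12 D22]]] := dense (sigma \o pi0) (N + k).
- exact: bij_comp.
- move=> x xM; rewrite /= ext0 // sE /sigma0; last by lia.
  by case: ltnP => ?; lia.
have pi2E x : pi0 x < N -> pi2 x = sigma0 (pi0 x).
  move=> xN; have sN : sigma (pi0 x) < N + k.
    by rewrite sE // /sigma0; case: (ltnP (pi0 x) M') => ?; lia.
  by rewrite ext2 //= sE.
set Y2 := oracle X pi2 in D12 D22; set F2 := transfer f setT pi2 in D12 D22.
set A2 := ce_set e Y2 in D12 D22.
have ord2 x y : pi0 x < N -> pi0 y < N -> (pi0 x < pi0 y) = (pi2 x < pi2 y).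
  move=> xN yN; rewrite !pi2E // /sigma0.
  case: (ltnP (pi0 x) M') => ?; case: (ltnP (pi0 y) M') => ?; lia.
have YY2 : agree n Y Y2 by apply: agree_oracle => x y /nN xN /nN yN; apply: ord2.
have nF2q : ~ join F2 Y2 q.
  move=> /join_double/rel_codeE; rewrite !encK => -[_ _].
  have cM0 := cM x0; have cN0 := cN x0.
  rewrite !pi2E !rhoK /sigma0; [|lia..].
  case: (ltnP (f x0) M') => ?; case: (ltnP x0 M') => ?; [lia..|].
  by move=> /esym.
(* [c1] must change its answer at [q] although the order looks the same, so [A] changes below [u].
   By [vP] old elements below [u] persist, so the change is a new element. *)
have [z zu [nAz A2z]] : exists2 z, z < u & ~ A z /\ A2 z.
  apply: contrapT => nz.
  have : agree u (join A Y) (join A2 Y2).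
    apply: agree_join; last by apply: agreeW YY2; rewrite leq_maxl.
    move=> z zu; split=> Az; last by apply: contrapT => nAz; apply: nz; exists z.
    by apply: (vP z zu).1 => //; apply: agreeW YY2; rewrite leq_maxr.
  by move=> /u1 /eval_functional/(_ ((D12 q).2 nF2q)).
have [w wP] := ce_set_use A2z.
have [R0 R0P] := finite_range_bounded pi2 w.
pose R := maxn R0 (N + k).
have BM' : B <= M' by lia.
have M'N : M' <= N by lia.
have [G [Gmon Gcomm] GK] := emb_interval_far fb mov (M' + k) cM cN BM' M'N.
(* Positions up to the end of the gap are kept, the shifted copy of [M', N) follows [G], and the
   remaining positions go after the last value of [G]. *)
pose t i := if i < M' + k then i else if i < N + k then G (i - k)
            else G N.-1 + i.
have tmon i j : i < j -> t i < t j.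
  move=> ij; rewrite /t; case: (ltnP i (M' + k)) => iM.
    case: (ltnP j (M' + k)) => jM //.
    case: (ltnP j (N + k)) => jN; last by lia.
    by have := GK (j - k); lia.
  case: (ltnP j (M' + k)) => jM; first by lia.
  case: (ltnP j (N + k)) => jN.
    have -> : i < N + k by lia.
    by apply: Gmon; lia.
  case: (ltnP i (N + k)) => iN; last by lia.
  have [->|ine] := eqVneq (i - k) N.-1; first by lia.
  by have := Gmon (i - k) N.-1; lia.
have tinj i j : t i = t j -> i = j.
  by move=> tij; have [/tmon|/tmon|//] := ltngtP i j; lia.
have tord i j : (i < j) = (t i < t j).
  apply/idP/idP => [/tmon//|]; have [//|/tmon|->] := ltngtP i j; lia.
have [tau taubij tauE] := @bij_extend t R (fun i j _ _ => @tinj i j).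
have [S SP] := finite_range_bounded t R.
have [||pi4 [pi4bij ext4 [D14 D24]]] := dense (tau \o pi2) S.
- exact: bij_comp.
- move=> x xM; have x0M : pi0 x < M' by rewrite ext0 //; lia.
  rewrite /= pi2E; last by lia.
  rewrite /sigma0 x0M tauE /t; last by lia.
  by rewrite ltn_addr // ext0.
have pi4E x : pi2 x < R -> pi4 x = t (pi2 x).
  by move=> xR; rewrite ext4 /= tauE //; apply: SP.
set Y4 := oracle X pi4 in D14 D24; set F4 := transfer f setT pi4 in D14 D24.
set A4 := ce_set e Y4 in D14 D24.
(* [t] preserves the order, so the enumeration of [z] survives. *)
have A4z : A4 z.
  apply: wP; apply: agree_oracle => x y /R0P xR /R0P yR.
  by rewrite !pi4E -?tord //; lia.
(* The total move from [pi0] to [pi4] below [N]. It commutes with [f], which restores the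
   transferred function on the elements below [n]. *)
pose g i := if i < M' then i else G i.
have g4 x : pi0 x < N -> pi4 x = g (pi0 x).
  move=> xN; have x2 := pi2E x xN; rewrite pi4E x2 /sigma0 /t /g; last first.
    by case: (ltnP (pi0 x) M') => ?; lia.
  case: (ltnP (pi0 x) M') => xM; first by rewrite ltn_addr.
  by rewrite !ltn_add2r xN ltnNge xM addnK.
have ginj i j : i < N -> j < N -> g i = g j -> i = j.
  rewrite /g => iN jN; case: (ltnP i M') => iM; case: (ltnP j M') => jM //.
  - by have := GK j; lia.
  - by have := GK i; lia.
  - by move=> gij; have [ij|ji|//] := ltngtP i j;
      [have := Gmon i j | have := Gmon j i]; lia.
have gcomm i : i < N -> g (f i) = f (g i).
  rewrite /g => iN; rewrite cM; case: (ltnP i M') => iM //.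
  by apply: Gcomm; rewrite iM.
have FF4 : agree n F F4.
  apply: agree_transfer => x y /nN xN /nN yN; rewrite !g4 // -gcomm //.
  split=> [->//|]; apply: ginj => //; by rewrite cN.
have YY4 : agree n Y Y4.
  apply: agree_oracle => x y /nN xN /nN yN; rewrite (ord2 x y) //.
  by rewrite !pi4E -?tord // pi2E // /sigma0; case: (ltnP _ M') => ?; lia.
have : eval (join F4 Y4) c2 z.*2 0.
  apply: (vP z zu).2 => //; apply: agree_join;
    by [apply: agreeW FF4; rewrite leq_maxr | apply: agreeW YY4; rewrite leq_maxr].
have J4 : join A4 Y4 z.*2 by apply/join_double.
by move=> /eval_functional/(_ ((D24 z.*2).1 J4)).
Qed.

(** * Enumeration of the programs and the limit of a chain of conditions *)

(** The fuel [k] bounds the depth of the decoded program. *)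
Fixpoint decode k z : code :=
  if k isn't k'.+1 then Zero else
  let l := decode k' (pi1 (pi2 z)) in let r := decode k' (pi2 (pi2 z)) in
  match pi1 z with
  | 0 => Succ | 1 => Fst | 2 => Snd | 3 => Oracle
  | 4 => Pair l r | 5 => Comp l r | 6 => Prec l r | 7 => Mu l
  | _ => Zero
  end.

Lemma decode_onto c : exists k z, forall j, k <= j -> decode j z = c.
Proof.
(* Stability under more fuel lets two components with different fuels be combined. [Mu] is treated
   as binary with a dummy second component. *)
have bin (C : code -> code -> code) i c1 c2 :
    (forall k z, pi1 z = i -> decode k.+1 z =
      C (decode k (pi1 (pi2 z))) (decode k (pi2 (pi2 z)))) ->
    (exists k z, forall j, k <= j -> decode j z = c1) ->
    (exists k z, forall j, k <= j -> decode j z = c2) ->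
    exists k z, forall j, k <= j -> decode j z = C c1 c2.
  move=> Ci [k1 [z1 H1]] [k2 [z2 H2]].
  exists (maxn k1 k2).+1, (enc i (enc z1 z2)) => -[//|j jk].
  by rewrite Ci ?encK // H1 ?H2 //; lia.
elim: c => [||||| c1 IH1 c2 IH2 | c1 IH1 c2 IH2 | c1 IH1 c2 IH2 | c IH].
- by exists 1, (enc 8 0) => -[|j] //= _; rewrite encK.
- by exists 1, (enc 0 0) => -[|j] //= _; rewrite encK.
- by exists 1, (enc 1 0) => -[|j] //= _; rewrite encK.
- by exists 1, (enc 2 0) => -[|j] //= _; rewrite encK.
- by exists 1, (enc 3 0) => -[|j] //= _; rewrite encK.
- by apply: (bin Pair 4) => // k z /= ->.
- by apply: (bin Comp 5) => // k z /= ->.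
- by apply: (bin Prec 6) => // k z /= ->.
- by apply: (bin (fun c _ => Mu c) 7 c c) => // k z /= ->.
Qed.

Lemma code_triples_countable :
  exists E : nat -> code * code * code, forall t, exists n, E n = t.
Proof.
pose D z := decode (pi1 z) (pi2 z).
have Donto c : exists z, D z = c.
  by have [k [z kz]] := decode_onto c; exists (enc k z); rewrite /D !encK kz.
exists (fun n => (D (pi1 n), D (pi1 (pi2 n)), D (pi2 (pi2 n)))) => -[[c1 c2] c3].
have [[z1 <-] [z2 <-] [z3 <-]] := And3 (Donto c1) (Donto c2) (Donto c3).
by exists (enc z1 (enc z2 z3)); rewrite !encK.
Qed.

(** The limit of a chain of conditions whose step [i] forces [P i] and also settles the element [i]
    and the occupant of position [i], so that the limit is a bijection. *)
Lemma generic_copy (P : nat -> (nat -> nat) -> Prop) :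
  (forall i pi M, bijective pi -> exists pi' N,
    [/\ bijective pi', extends M pi pi' &
      forall pi'', bijective pi'' -> extends N pi' pi'' -> P i pi'']) ->
  exists2 pi, bijective pi & forall i, P i pi.
Proof.
move=> step.
have /choice[next nextP] : forall s : nat * ((nat -> nat) * nat),
    exists r : (nat -> nat) * nat, bijective s.2.1 ->
      [/\ bijective r.1, extends s.2.2 s.2.1 r.1, s.2.2 <= r.2,
          r.1 s.1 < r.2 /\ s.1 < r.2 &
          forall pi, bijective pi -> extends r.2 r.1 pi -> P s.1 pi].
  move=> [i [pi M]] /=; case: (pselect (bijective pi)) => [bpi|]; last by exists (id, 0).
  have [pi' [N [bpi' ext PN]]] := step i pi M bpi.
  (* Exceeding [pi' i] settles the element [i]; exceeding [i] settles the occupant of position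
     [i]. *)
  exists (pi', N + M + pi' i + i.+1) => _ /=; split=> //; [lia|lia|].
  move=> pi'' bpi'' ext''; apply: PN => // x xN; apply: ext''; lia.
pose st := fix st i := if i isn't j.+1 then (id, 0) else next (j, st j).
have stb i : bijective (st i).1.
  elim: i => [|i IHi] /=; first by exists id.
  by have [] := nextP (i, st i) IHi.
have stP i := nextP (i, st i) (stb i).
have ext i j : i <= j -> (st i).2 <= (st j).2 /\ extends (st i).2 (st i).1 (st j).1.
  elim: j => [|j IHj]; first by rewrite leqn0 => /eqP->; split.
  rewrite leq_eqVlt => /orP[/eqP->//|]; rewrite ltnS => /IHj[leN extj].
  have [_ ext1 leN1 _ _] := stP j; split; first exact: leq_trans leN1.
  move=> x xN; rewrite -(extj x xN); apply: ext1; rewrite /= extj //; lia.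
pose lim x := (st x.+1).1 x.
have limE x i : x < i -> lim x = (st i).1 x.
  move=> xi; have [_ exti] := ext _ _ xi; rewrite exti //.
  by have [_ _ _ []] := stP x.
have extlim i : extends (st i).2 (st i).1 lim.
  move=> x xN; have [ix|xi] := leqP i x.+1; last by apply: limE; lia.
  by have [_ exti] := ext _ _ ix; apply: exti.
have lim_inj : injective lim.
  move=> x y; rewrite (@limE x (maxn x y).+1) ?(@limE y (maxn x y).+1); [|lia..].
  exact: bij_inj.
have /choice[g gK] : forall y, exists x, lim x = y.
  move=> y; have [g _ gK] := stb y.+1; exists (g y).
  by rewrite (extlim y.+1) gK //; have [_ _ _ []] := stP y.
have limbij : bijective lim by exists g => // x; apply: lim_inj; rewrite gK.
exists lim => // i; have [_ _ _ _] := stP i; apply=> //.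
exact: (extlim i.+1).
Qed.

Lemma movable_not_ce f B : block_function f ->
  (forall N, exists2 x, N <= x & f x <> x) ->
  (forall c d, cut_pair f c d -> B <= c -> movable f c d) ->
  ~ intrinsically_ce_degree_on_cone f.
Proof.
move=> fb nid mov [X Xce].
have [E Eonto] := code_triples_countable.
have [i pi0 M pi0bij|pi pibij nsame] := @generic_copy (fun i pi =>
    ~ same_degree X f (E i).1.1 (E i).1.2 (E i).2 pi).
  exact: generic_step fb nid mov pi0bij.
pose Y := oracle X pi.
have [lin iso] := bij_copy pibij.
have [|A [e defA] /deg_eqP[[c1 D1] [c2 D2]]] := Xce Y (turing_le_joinl _ _)
    (deg (join (transfer f setT pi) Y)).
  exists setT, (fun x y => pi x < pi y), pi; split=> //; split.
    exact: turing_leT.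
  exact: turing_le_joinr.
have [n En] := Eonto (e, c1, c2).
by have := nsame n; rewrite En /= /same_degree; apply; rewrite -/Y /ce_set -defA.
Qed.

(** * Recovering the isomorphism *)

(** The apparent position of [x] at stage [t], when only the elements below [t] have been seen. *)
Definition rank (R : set nat) t x :=
  count (fun y => char R (enc y x)) (iota 0 t).

Lemma char_rel_code R x y : char (rel_code R) (enc x y) = `[< R x y >].
Proof. by apply: asbool_equiv_eq; rewrite rel_codeE !encK. Qed.

(** Once all predecessors of [x] are seen, their list is a permutation of the image under the
    inverse isomorphism of the positions below [pi x]. *)
Lemma rank_limit L prec pi t x : linear_order L prec -> is_iso L prec pi ->
  L x -> (forall y, prec y x -> y < t) -> rank (rel_code prec) t x = pi x.
Proof.
move=> [precL _ _ _] iso Lx xt; have [rho [Lrho rhoK piK]] := iso_inverse iso.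
have [_ isoP] := iso.
rewrite /rank -size_filter -[RHS](size_iota 0) -[RHS](size_map rho).
apply/perm_size/uniq_perm; first exact/filter_uniq/iota_uniq.
  by rewrite map_inj_uniq ?iota_uniq // => i j ij; rewrite -(rhoK i) ij rhoK.
move=> y; rewrite mem_filter mem_iota char_rel_code add0n /=.
apply/andP/mapP => [[/asboolP yx _]|[i]].
  have [Ly _] := precL _ _ yx; exists (pi y); last by rewrite piK.
  by rewrite mem_iota add0n /=; apply/isoP.
rewrite mem_iota add0n /= => ix ->; suff ixp : prec (rho i) x.
  by split; [apply/asboolP | apply: xt].
by apply/isoP => //; rewrite rhoK.
Qed.

Lemma predecessors_bounded L prec pi x : linear_order L prec ->
  is_iso L prec pi -> exists t, forall y, prec y x -> y < t.
Proof.
move=> [precL _ _ _] iso; have [rho [Lrho rhoK piK]] := iso_inverse iso.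
have [_ isoP] := iso.
have [t tP] := finite_range_bounded rho (pi x).
exists t => y yx; have [Ly Lx] := precL _ _ yx.
by rewrite -(piK _ Ly); apply/tP/isoP.
Qed.

(** The rank at a late stage is the true position; between the two stages it grows by one for each
    late predecessor. *)
Lemma rank_lt L prec pi t x : linear_order L prec -> is_iso L prec pi -> L x ->
  rank (rel_code prec) t x < pi x <-> exists y, t <= y /\ prec y x.
Proof.
move=> lin iso Lx; split=> [lt_rank|[y [ty yx]]].
  apply: contrapT => nex; move: lt_rank; rewrite (rank_limit lin iso) ?ltnn //.
  by move=> y yx; rewrite ltnNge; apply/negP => ty; apply: nex; exists y.
have [u uP] := predecessors_bounded x lin iso; have yu := uP y yx.
have tu : t <= u by lia.
rewrite -(rank_limit lin iso Lx uP) /rank -(subnKC tu) iotaD count_cat.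
rewrite -addn1 leq_add2l add0n -has_count; apply/hasP; exists y.
  by rewrite mem_iota; lia.
by rewrite char_rel_code; apply/asboolP.
Qed.

(* e lists, in increasing order, the positions in L of the elements of L
   below t. *)
Lemma rank_listing L prec pi t : linear_order L prec -> is_iso L prec pi ->
  exists (e : nat -> nat) (n : nat),
    [/\ forall i j, i < j -> j < n -> e i < e j,
        forall x, L x -> x < t ->
          rank (rel_code prec) t x < n /\ e (rank (rel_code prec) t x) = pi x &
        forall i, i < n -> exists x,
          [/\ L x, x < t & rank (rel_code prec) t x = i]].
Proof.
move=> [precL _ _ _] iso; have [rho [Lrho rhoK piK]] := iso_inverse iso.
have [_ isoP] := iso.
pose s0 := [seq pi y | y <- iota 0 t & char L y].
pose s := sort leq s0.
have s_lt : sorted ltn s.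
  rewrite ltn_sorted_uniq_leq sort_sorted ?andbT; last exact: leq_total.
  rewrite sort_uniq map_inj_in_uniq ?filter_uniq ?iota_uniq //.
  move=> x y; rewrite !mem_filter => /andP[/asboolP Lx _] /andP[/asboolP Ly _].
  by move=> xy; rewrite -(piK _ Lx) xy piK.
(* The rank counts the listed positions below [pi x], so it is the index of [pi x] in the sorted
   list [s]. *)
have rankE x : L x -> rank (rel_code prec) t x = count (fun v => v < pi x) s.
  move=> Lx; rewrite count_sort count_map count_filter; apply: eq_count => y /=.
  rewrite char_rel_code; apply/asboolP/andP => [yx|[yx /asboolP Ly]].
    have [Ly _] := precL _ _ yx; split; last exact/asboolP.
    exact/isoP.
  exact/isoP.
have mem_s v : reflect (exists x, [/\ L x, x < t & v = pi x]) (v \in s).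
  rewrite mem_sort; apply: (iffP mapP) => [[x]|[x [Lx xt ->]]].
    by rewrite mem_filter mem_iota => /andP[/asboolP Lx] /=; exists x.
  by exists x => //; rewrite mem_filter mem_iota add0n /= xt andbT; apply/asboolP.
have count_nth i : i < size s -> count (fun v => v < nth 0 s i) s = i.
  exact: Order.POrderTheory.count_lt_nth.
exists (nth 0 s), (size s); split=> [i j ij js|x Lx xt|i ilt].
- by apply: (sorted_ltn_nth ltn_trans 0 s_lt) => //=; rewrite inE; lia.
- have : pi x \in s by apply/mem_s; exists x.
  move=> /(nthP 0)[j js jx].
  by rewrite rankE // -jx count_nth.
- have /mem_s[x [Lx xt xi]] := mem_nth 0 ilt.
  by exists x; split=> //; rewrite rankE // -xi count_nth.
Qed.

(* If at stage t the elements of L that seem to occupy the block [c, b] carry the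
   right values of f^L, their true positions give an embedding of the block,
   whose image must be [c, b] itself. *)
Lemma rank_correct f L prec pi c b t w :
  let r := rank (rel_code prec) t in
  linear_order L prec -> is_iso L prec pi ->
  cut_pair f c b.+1 -> ~ movable f c b.+1 -> L w -> w < t -> r w = b ->
  (forall y y', y < t -> y' < t -> L y -> L y' -> c <= r y <= b ->
    r y' = f (r y) -> pi y' = f (pi y)) ->
  forall x, L x -> x < t -> r x <= b -> r x = pi x.
Proof.
move=> r lin iso cp nmov Lw wt rw copy.
have [e [n [emon eP en]]] := rank_listing t lin iso; rewrite -/r in eP en.
have bn : b < n by rewrite -rw; case: (eP w).
have [cc cb ltcb _] := cp.
have eE : emb f c b.+1 e.
  split=> [i j _ ij jb|i iI]; first by apply: emon => //; lia.
  have := cc i; have := cb i => fib fic.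
  have [|y [Ly yt ry]] := en i; first by lia.
  have [|y' [Ly' y't ry']] := en (f i); first by lia.
  have [_ ey] := eP _ Ly yt; have [_ ey'] := eP _ Ly' y't.
  rewrite -ry' ey' -ry ey; apply: copy => //; rewrite ?ry //; lia.
(* As the block is not movable, its image starts by [b] and hence also ends by [b]. *)
have ecb : e c < b.+1 by rewrite ltnNge; apply/negP => ec; apply: nmov; exists e.
have below := emb_below_cut cp cb eE ecb.
(* A strictly increasing [e] that maps [b] to at most [b] is the identity up to [b], also at the
   positions before [c]. *)
have ele i : i <= b -> i <= e i.
  elim: i => // i IHi ib; have := emon i i.+1; have := IHi; lia.
have ege k : k <= b -> e (b - k) <= b - k.
  elim: k => [|k IHk] kb; first by have := below b; rewrite subn0; lia.
  by have := emon (b - k.+1) (b - k); have := IHk; lia.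
move=> x Lx xt rx; have [_ <-] := eP x Lx xt.
have := ele _ rx; have := ege (b - r x); rewrite subKn //.
by have := leq_subr (r x) b; lia.
Qed.

Lemma computable_rank Y R k x : turing_le R Y -> computable Y k ->
  computable Y x -> computable Y (fun n => rank R (k n) (x n)).
Proof.
move=> RY Yk Yx.
apply: (@computable_count Y k (fun n y => char R (enc y (x n)))) => //.
apply: computable_char => //; apply: computable_enc.
  exact: computable_pi2 (computable_id Y).
exact: computable_comp Yx (computable_pi1 (computable_id Y)).
Qed.

Ltac computability := repeat first
  [ assumption | exact: computable_id | apply: computable_char
  | apply: computable_rank | apply: computable_and | apply: computable_or
  | apply: computable_neg | apply: computable_leq | apply: computable_enc
  | apply: computable_pi1 | apply: computable_pi2 | apply: computable_succ
  | exact: computable_const ].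

(** * The degree of the isomorphism *)

(** Outside this set, the second component is a stage from which the rank of the first is final. *)
Definition unsettled R :=
  [set z | exists y, (pi2 z <= y) && char R (enc y (pi1 z))].

Lemma unsettled_ce R Y : turing_le R Y -> ce_in (unsettled R) Y.
Proof.
move=> RY; apply: (@ce_exists Y (fun z y => (pi2 z <= y) && char R (enc y (pi1 z)))).
by computability.
Qed.

Lemma unsettledE prec z : unsettled (rel_code prec) z <->
  exists y, pi2 z <= y /\ prec y (pi1 z).
Proof.
split=> -[y]; first by move=> /andP[zy]; rewrite char_rel_code => /asboolP; exists y.
by move=> [zy yz]; exists y; rewrite zy char_rel_code; apply/asboolP.
Qed.

(** Search for a stage at which both elements of a pair are settled; their ranks are then true
    positions and can be compared through the graph of [f]. *)
Lemma transfer_le_unsettled f L prec pi Z :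
  linear_order L prec -> is_iso L prec pi ->
  turing_le L Z -> turing_le (rel_code prec) Z ->
  turing_le (rel_code (fun x y => y = f x)) Z ->
  turing_le (unsettled (rel_code prec)) Z -> turing_le (transfer f L pi) Z.
Proof.
move=> lin iso LZ RZ GZ AZ; have [precL _ _ _] := lin.
set R := rel_code prec in RZ AZ *; set G := rel_code _ in GZ.
have [|z|s Zs sP] := @computable_search Z (fun z s =>
    ~~ char (unsettled R) (enc (pi1 z) s) && ~~ char (unsettled R) (enc (pi2 z) s)).
- by computability.
- have [t1 t1P] := predecessors_bounded (pi1 z) lin iso.
  have [t2 t2P] := predecessors_bounded (pi2 z) lin iso.
  exists (maxn t1 t2); apply/andP; split; apply/asboolP => /unsettledE[y].
    by rewrite !encK => -[ty /t1P]; lia.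
  by rewrite !encK => -[ty /t2P]; lia.
apply/turing_leE; apply: (@computable_ext Z (fun z => char L (pi1 z) &&
  (char L (pi2 z) &&
   char G (enc (rank R (s z) (pi1 z)) (rank R (s z) (pi2 z)))))); last first.
  by computability.
have rankE x z : L x -> ~~ char (unsettled R) (enc x (s z)) ->
    rank R (s z) x = pi x.
  move=> Lx /asboolP nA; apply: (rank_limit lin iso) => // y yx.
  rewrite ltnNge; apply/negP => sy; apply: nA; apply/unsettledE.
  by exists y; rewrite !encK.
move=> z; congr nat_of_bool; have /andP[s1 s2] := sP z.
apply/and3P/asboolP => [[/asboolP L1 /asboolP L2]|/rel_codeE[L1 L2 fz]].
  by rewrite char_rel_code !rankE // => /asboolP fz; apply/rel_codeE.
by split; try exact/asboolP; rewrite char_rel_code !rankE //; apply/asboolP.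
Qed.

(** Search for a stage showing a faithful copy of a non-movable block, with the given element not
    after its end. By [rank_correct] the rank is then final, and comparing it with the rank at the
    queried stage decides. *)
Lemma unsettled_le_transfer f L prec pi Z :
  (forall N, exists c d, [/\ cut_pair f c d, N <= c & ~ movable f c d]) ->
  linear_order L prec -> is_iso L prec pi ->
  turing_le L Z -> turing_le (rel_code prec) Z ->
  turing_le (rel_code (fun x y => y = f x)) Z ->
  turing_le (rel_code (fun c b => cut_pair f c b.+1 /\ ~ movable f c b.+1)) Z ->
  turing_le (transfer f L pi) Z -> turing_le (unsettled (rel_code prec)) Z.
Proof.
move=> inf lin iso LZ RZ GZ KZ FZ; have [precL _ _ _] := lin.
have [rho [Lrho rhoK piK]] := iso_inverse iso; have [_ isoP] := iso.
set R := rel_code prec in RZ *; set G := rel_code _ in GZ.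
set K := rel_code _ in KZ; set F := transfer f L pi in FZ.
(* The input is <<x, s>, <w, <t, c>>>, where [w] seems at stage [t] to be the last element of a
   block starting at [c]. *)
pose x n := pi1 (pi1 n); pose w n := pi1 (pi2 n).
pose t n := pi1 (pi2 (pi2 n)); pose c n := pi2 (pi2 (pi2 n)).
pose copy n y y' := ~~ char L y || (~~ char L y' ||
  (~~ (c n <= rank R (t n) y) || (~~ (rank R (t n) y <= rank R (t n) (w n)) ||
  (~~ char G (enc (rank R (t n) y) (rank R (t n) y')) || char F (enc y y'))))).
(* Elements outside [L] pass at once, so that the search is total. *)
pose test n := ~~ char L (x n) || ((w n < t n) && (char L (w n) &&
  ((x n < t n) && ((rank R (t n) (x n) <= rank R (t n) (w n)) &&
  (char K (enc (c n) (rank R (t n) (w n))) &&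
   all (fun y => all (copy n y) (iota 0 (t n))) (iota 0 (t n))))))).
have Ztest : computable Z test.
  have Zall : computable Z
      (fun n => all (fun y => all (copy n y) (iota 0 (t n))) (iota 0 (t n))).
    apply: (@computable_all Z t (fun n y => all (copy n y) (iota 0 (t n)))).
      by rewrite /t; computability.
    apply: (@computable_all Z (fun q => t (pi1 q)) (fun q => copy (pi1 q) (pi2 q))).
      by rewrite /t; computability.
    by rewrite /copy /t /c /w; computability.
  by rewrite /test; computability; rewrite /x /w /t /c; computability.
have [|z|m Zm mP] := @computable_search Z (fun z m => test (enc z m)).
- by apply: computable_ext Ztest => n; rewrite -encP.
- rewrite /test /copy /x /w /t /c.
  have [/asboolP Lx|nLx] := boolP (char L (pi1 z)); last by exists 0; rewrite !encK nLx.
  (* The search succeeds for a non-movable block from the position of the element on, at a stage [u]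
     past all elements at positions up to the block's end [b]. *)
  have [c0 [d [cp xc nmov]]] := inf (pi (pi1 z)).
  have [_ _ ltcd _] := cp; have dK : d = d.-1.+1 by lia.
  rewrite dK in cp nmov ltcd; set b := d.-1 in cp nmov ltcd.
  have [u uP] := finite_range_bounded rho b.+1.
  have ltu y : L y -> pi y <= b -> y < u.
    by move=> Ly yb; rewrite -(piK _ Ly); apply: uP.
  have rankE y : L y -> pi y <= b -> rank R u y = pi y.
    move=> Ly yb; apply: (rank_limit lin iso) => // v vy.
    have [Lv _] := precL _ _ vy; apply: ltu => //.
    by have := (isoP _ _ Lv Ly).1 vy; lia.
  have Lb : L (rho b) by [].
  have rankb : rank R u (rho b) = b by rewrite rankE ?rhoK.
  (* The listing of positions is increasing and fixes [b], so an apparent rank up to [b] comes from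
     a true position up to [b]. *)
  have rank_pi y : L y -> y < u -> rank R u y <= b -> pi y <= b.
    move=> Ly yu ryb; rewrite leqNgt; apply/negP => by_.
    have [e [n [emon eP _]]] := rank_listing u lin iso.
    have [ryn ey] := eP y Ly yu; have [_ eb] := eP _ Lb (uP _ (ltnSn b)).
    rewrite -/R in ryn ey eb; move: eb ey; rewrite rankb rhoK => eb ey.
    have [rb|rb] := eqVneq (rank R u y) b; first by move: ey; rewrite rb; lia.
    have rltb : rank R u y < b by lia.
    have := emon _ b rltb; rewrite ey eb => /(_ _)/ltnW.
    have [bn _] := eP _ Lb (uP _ (ltnSn b)); rewrite -/R rankb in bn.
    by move=> /(_ bn); lia.
  exists (enc (rho b) (enc u c0)); rewrite !encK; apply/orP; right.
  have xu : pi1 z < u by apply: ltu => //; lia.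
  rewrite uP // xu rankb rankE; [|done|lia].
  apply/and5P; split=> //; [exact/asboolP|lia|].
  apply/andP; split; first by rewrite char_rel_code; apply/asboolP.
  apply/allP => y; rewrite mem_iota add0n /= => yu.
  apply/allP => y'; rewrite mem_iota add0n /= => y'u.
  rewrite !char_rel_code.
  case: (boolP (char L y)) => //= /asboolP Ly.
  case: (boolP (char L y')) => //= /asboolP Ly'.
  case: (leqP c0 (rank R u y)) => //= cy.
  case: (leqP (rank R u y) b) => //= yb.
  case: asboolP => //= fy.
  have [_ cb _ _] := cp.
  have y'b : rank R u y' <= b by rewrite fy -ltnS cb.
  apply/asboolP; split=> //.
  rewrite -(rankE y' Ly' (rank_pi _ Ly' y'u y'b)).
  by rewrite -(rankE y Ly (rank_pi _ Ly yu yb)).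
pose stage z := pi1 (pi2 (m z)).
apply/turing_leE; apply: (@computable_ext Z (fun z => char L (pi1 z) &&
  (rank R (pi2 z) (pi1 z) < rank R (stage z) (pi1 z)))); last first.
  by rewrite /stage; apply: computable_and; computability.
move=> z; congr nat_of_bool.
have := mP z; rewrite /test /copy /x /w /t /c !encK -/(stage z).
case: (boolP (char L (pi1 z))) => /= [/asboolP Lx|/asboolP nLx _]; last first.
  by apply/esym/asboolP => /unsettledE[y [_ /precL[]]].
set w0 := pi1 (m z); set c0 := pi2 _.
move=> /and5P[wt /asboolP Lw xt xw /andP[]].
rewrite char_rel_code => /asboolP[cp nmov] /allP cop.
have rx : rank R (stage z) (pi1 z) = pi (pi1 z).
  apply: (rank_correct lin iso cp nmov Lw wt erefl) => //.
  move=> y y' yt y't Ly Ly' /andP[cy yw] fy.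
  have /cop/allP copy_y : y \in iota 0 (stage z) by rewrite mem_iota.
  have /copy_y : y' \in iota 0 (stage z) by rewrite mem_iota.
  have -> : char L y by apply/asboolP.
  have -> : char L y' by apply/asboolP.
  rewrite cy yw !char_rel_code /= => /orP[/asboolP//|].
  by move=> /asboolP[].
rewrite rx; apply/idP/asboolP.
  by move=> /(rank_lt _ lin iso Lx).1 H; apply/unsettledE.
by move=> /unsettledE H; apply/(rank_lt _ lin iso Lx).
Qed.

Lemma non_movable_ce f :
  (forall N, exists c d, [/\ cut_pair f c d, N <= c & ~ movable f c d]) ->
  intrinsically_ce_degree_on_cone f.
Proof.
move=> inf; pose G := rel_code (fun x y => y = f x).
pose K := rel_code (fun c b => cut_pair f c b.+1 /\ ~ movable f c b.+1).
(* The base of the cone knows the graph of [f] and which cut pairs are not movable. *)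
exists (join G K) => Y GKY _ [L [prec [pi [lin iso [LY RY] ->]]]].
have GY : turing_le G Y := turing_le_trans (turing_le_joinl G K) GKY.
have KY : turing_le K Y := turing_le_trans (turing_le_joinr G K) GKY.
exists (unsettled (rel_code prec)); first exact: unsettled_ce.
apply/deg_eqP; split; apply: turing_le_join; try exact: turing_le_joinr.
  by apply: (transfer_le_unsettled lin iso);
    by [apply: turing_le_joinl |
        apply: turing_le_trans (turing_le_joinr _ _); assumption].
by apply: (unsettled_le_transfer inf lin iso);
  by [apply: turing_le_joinl |
      apply: turing_le_trans (turing_le_joinr _ _); assumption].
Qed.

Theorem theorem3p3 (f : nat -> nat) (f_block : block_function f)
    (f_ncomp : ~ intrinsically_computable_on_cone f) :
  intrinsically_ce_degree_on_cone f <->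
  infinite_set [set B : set nat | is_block f B /\
    ~ exists C, [/\ is_block f C, later C B & embeds f B C]].
Proof.
split=> [ce fin|/(infinite_non_movable f_block)]; last exact: non_movable_ce.
have [N mov] := finite_movable f_block fin.
apply: movable_not_ce f_block _ mov ce => M; apply: contrapT => fid.
apply: f_ncomp; apply: (@eventually_identity_computable f M) => x Mx.
by apply: contrapT => fx; apply: fid; exists x.
Qed.
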